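(* Let $\Gamma$ and $\Gamma^\dagger$ be Abelian groups, and let $G$ and $G^\dagger$ be graphs. Suppose $G$ is $\Gamma$-vertex magic with a labeling $\ell$ and magic constant $g$ such that $\ell(x)=g$ for all $x\in V(G)$, and $G^\dagger$ is $\Gamma^\dagger$-vertex magic with a labeling $\ell^\dagger$ and magic constant $g^\dagger$ such that $\sum_{y\in V(G^\dagger)}\ell^\dagger(y)=g^\dagger$. Then the corona product $G\odot G^\dagger$ is $\Gamma\times\Gamma^\dagger$-vertex magic.
   Context: Graphs are finite, simple and undirected. For an additive Abelian group $\Gamma$ with identity $0$ and a graph $G$, a $\Gamma$-vertex magic labeling is a map $\ell:V(G)\to\Gamma\setminus\{0\}$ for which there is $\mu\in\Gamma$ (the magic constant) with $w(v)=\sum_{u\in N(v)}\ell(u)=\mu$ for every vertex $v$; $G$ is $\Gamma$-vertex magic if it has such a labeling. $\Gamma\times\Gamma^\dagger$ is the direct product with componentwise addition. The corona product $G\odot H$ is obtained from one copy of $G$ and $|V(G)|$ copies of $H$ by joining the $i$-th vertex of $G$ by an edge to every vertex of the $i$-th copy of $H$. *)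

(* Defs.v *)
From HB Require Import structures.
From mathcomp Require Import all_boot all_order all_algebra.

Set Implicit Arguments.
Unset Strict Implicit.
Unset Printing Implicit Defensive.

Import GRing.Theory.
Local Open Scope ring_scope.

Record sgraph := SGraph {
  vertex :> finType;
  adj : rel vertex;
  adj_sym : symmetric adj;
  adj_irrefl : irreflexive adj
}.

Definition neighbors (G : sgraph) (v : G) : {set G} := [set u | adj v u].

Definition weight (A : zmodType) (G : sgraph) (l : G -> A) (v : G) : A :=
  \sum_(u in neighbors v) l u.

Definition magic_labeling (A : zmodType) (G : sgraph) (l : G -> A) (mu : A) :
    Prop :=
  (forall v : G, l v <> 0) /\ (forall v : G, weight l v = mu).

Definition vertex_magic (A : zmodType) (G : sgraph) : Prop :=
  exists (l : G -> A) (mu : A), magic_labeling l mu.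

(* [inl x] is the vertex x of G; [inr (x, y)] is the vertex y of the copy of H
   attached to x. *)
Definition corona_adj (G H : sgraph) : rel (G + G * H)%type :=
  fun a b =>
    match a, b with
    | inl x, inl x' => adj x x'
    | inl x, inr (x', _) => x == x'
    | inr (x, _), inl x' => x == x'
    | inr (x, y), inr (x', y') => (x == x') && adj y y'
    end.

Lemma corona_adj_sym (G H : sgraph) : symmetric (@corona_adj G H).
Proof.
by move=> [x|[x y]] [x'|[x' y']] //=; rewrite ?(eq_sym x) // adj_sym.
Qed.

Lemma corona_adj_irrefl (G H : sgraph) : irreflexive (@corona_adj G H).
Proof. by move=> [x|[x y]] /=; rewrite adj_irrefl ?andbF. Qed.

Definition corona (G H : sgraph) : sgraph :=
  SGraph (@corona_adj_sym G H) (@corona_adj_irrefl G H).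

(* Main.v *)
(* Label a vertex x of G by (l x, 0) and a vertex y of any copy of G' by
   (0, l' y). At x the weight is (g, 0) from G plus (0, sum of l') from the
   attached copy; at a copy of y it is (l x, 0) from the root x, where l x = g,
   plus (0, g') from the copy. Both are (g, g'). *)
Require Import Defs.
From HB Require Import structures.
From mathcomp Require Import all_boot all_order all_algebra.

Set Implicit Arguments.
Unset Strict Implicit.
Unset Printing Implicit Defensive.

Import GRing.Theory.
Local Open Scope ring_scope.

Lemma weightE (A : zmodType) (G : sgraph) (l : G -> A) (v : G) :
  weight l v = \sum_(u | adj v u) l u.
Proof. by apply: eq_bigl => u; rewrite inE. Qed.

(** Serves both kinds of neighbours inside a copy: [P] is [predT] as seen from the root [x], and
    [adj y] as seen from a vertex [y] of the copy. *)
Lemma sum_fiber (A : zmodType) (I J : finType) (P : pred J) (x : I)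
  (F : I * J -> A) :
  \sum_(p | (x == p.1) && P p.2) F p = \sum_(y | P y) F (x, y).
Proof.
(* Separating the two coordinates lets [pair_big] split the sum; the outer index is then confined to
   [x]. *)
rewrite (eq_big (fun p => pred1 x p.1 && P p.2) (fun p => F (p.1, p.2))).
- by rewrite -(pair_big (pred1 x) P (fun i j => F (i, j))) big_pred1_eq.
- by move=> p; rewrite /= eq_sym.
by case.
Qed.

Lemma weight_corona_inl (A : zmodType) (G H : sgraph) (f : corona G H -> A)
  (x : G) :
  weight f (inl x : corona G H) =
  weight (fun x' : G => f (inl x')) x + \sum_(y : H) f (inr (x, y)).
Proof.
rewrite !weightE big_sumType /=; congr (_ + _).
rewrite -(sum_fiber predT x (fun p => f (inr p))).
by apply: eq_bigl => -[x' y] /=; rewrite andbT.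
Qed.

Lemma weight_corona_inr (A : zmodType) (G H : sgraph) (f : corona G H -> A)
  (x : G) (y : H) :
  weight f (inr (x, y) : corona G H) =
  f (inl x) + weight (fun y' : H => f (inr (x, y'))) y.
Proof.
rewrite !weightE big_sumType /=; congr (_ + _).
  (* Each vertex of a copy has exactly one neighbour in [G], its root [x]. *)
  by rewrite (eq_bigl (pred1 x)) ?big_pred1_eq // => x' /=; rewrite eq_sym.
rewrite -(sum_fiber (adj y) x (fun p => f (inr p))).
by apply: eq_bigl => -[x' y'].
Qed.

Lemma sum_pair (A B : zmodType) (I : finType) (P : pred I) (F : I -> A)
  (F' : I -> B) :
  \sum_(i | P i) (F i, F' i) = (\sum_(i | P i) F i, \sum_(i | P i) F' i).
Proof. by elim/big_rec3: _ => // i a b c _ ->. Qed.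

Theorem theorem3p4 (A A' : zmodType) (G G' : sgraph)
  (l : G -> A) (g : A) (l' : G' -> A') (g' : A')
  (hl : magic_labeling l g) (hlg : forall x : G, l x = g)
  (hl' : magic_labeling l' g') (hlg' : \sum_(y : G') l' y = g') :
  vertex_magic (A * A')%type (corona G G').
Proof.
case: hl => l_neq0 l_mu; case: hl' => l'_neq0 l'_mu.
pose f (v : corona G G') : (A * A')%type :=
  match v with inl x => (l x, 0) | inr (_, y) => (0, l' y) end.
exists f, (g, g'); split=> [[x|[x y]]|[x|[x y]]].
- by case=> /l_neq0.
- by case=> /l'_neq0.
(* [big1] removes the two zero sums: second coordinates over the neighbours in [G], first
   coordinates over the copy. *)
- rewrite weight_corona_inl weightE !sum_pair -weightE l_mu hlg' !big1 //.
  by congr (_, _); rewrite ?addr0 ?add0r.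
rewrite weight_corona_inr weightE sum_pair big1 // -weightE l'_mu /f hlg.
by congr (_, _); rewrite ?addr0 ?add0r.
Qed.
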